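(* On HDAs over $\Sigma$, shp-bisimilarity is strictly contained in ST-bisimilarity: ${\underline{\leftrightarrow}_{shp}}\subsetneq{\underline{\leftrightarrow}_{ST}}$. In fact, even ${\underline{\leftrightarrow}_{shp}}\not\supseteq{\underline{\leftrightarrow}_{ureST}}$, i.e. there are HDAs that are ureST-bisimilar but not shp-bisimilar.
   Context: HDAs. $\Sigma$ is a fixed set of actions, containing pairwise distinct actions $a,b,c,d$. A conclist is $U=(n,\lambda)$ with $n\in\mathbb N$ and $\lambda:\{1<\dots<n\}\to\Sigma$. The category $\square$ has conclists as objects; a morphism $(m,\lambda)\to(n,\mu)$ is a pair $(f,\varepsilon)$ with $f:\{1,\dots,m\}\to\{1,\dots,n\}$ injective, order- and label-preserving, and $\varepsilon:\{1,\dots,n\}\to\{0,*,1\}$ with $\varepsilon^{-1}( * )=\mathrm{im} f$; composition is $(g,\zeta)\circ(f,\varepsilon)=(g\circ f,\eta)$ with $\eta(g(t))=\varepsilon(t)$ and $\eta(u)=\zeta(u)$ for $u\notin\mathrm{im}\,g$. For $1\le i\le n$, $k\in\{0,1\}$, the coface map $d_i^k:U\to V$ ($V$ of dimension $n$, $U$ of dimension $n-1$) has $f$ omitting position $i$, $\varepsilon(i)=k$, and $\varepsilon(j)=*$ for $j\ne i$. A precubical set is a functor $X:\square^{op}\to\mathbf{Set}$; elements of $X[U]$, $U=(n,\lambda)$, are $n$-dimensional cells, and $\delta_i^k:=X[d_i^k]$. An HDA is a pair $(X,i)$ of a precubical set and an initial $0$-dimensional cell $i$. Paths. A path of an HDA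 $\mathcal X$ is a sequence $\alpha=(x_0,\varphi_1,x_1,\dots,\varphi_n,x_n)$ ($n\ge 0$) with $x_0$ the initial cell, $x_j\in X[U_j]$, where for each $j$ either $\varphi_j=d^0_{i_j}:U_{j-1}\to U_j$ with $x_{j-1}=\delta^0_{i_j}(x_j)$ (up-step, starting an event) or $\varphi_j=d^1_{i_j}:U_j\to U_{j-1}$ with $x_j=\delta^1_{i_j}(x_{j-1})$ (down-step, ending an event). $\alpha\hookrightarrow\alpha'$ means $\alpha$ is a prefix of $\alpha'$. $\alpha\leftrightarrows^\ell\beta$ ($\ell$-similarity): one of $\alpha,\beta$ is obtained from the other by replacing, around the cell $x_\ell$, $(d_i^0,x_\ell,d_j^0)$ by $(d_{j-1}^0,x'_\ell,d_i^0)$, or $(d_j^1,x_\ell,d_i^1)$ by $(d_i^1,x'_\ell,d_{j-1}^1)$, for some $i<j$ and some cell $x'_\ell$. $\alpha\sqsubseteq^\ell\beta$ ($\beta$ subsumes $\alpha$ at $\ell$): $\alpha$ is obtained from $\beta$ by replacing, around $x_\ell$, $(d_i^0,x_\ell,d_j^1)$ by $(d_{j-1}^1,x'_\ell,d_i^0)$, or $(d_j^0,x_\ell,d_i^1)$ by $(d_i^1,x'_\ell,d_{j-1}^0)$, for some $i<j$. ST-traces. Given a down-step at position $p$ of a path, move it to the left: as long as the step directly before it is a down-step, or an up-step whose index differs from the current index of the moving down-step, there is a unique replacement moving it one position left: for some $i<j$ and cells $x,x'$, it replaces $(d_j^1,x,d_i^1)$ by $(d_i^1,x',d_{j-1}^1)$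 or conversely (if the step directly before is a down-step), or it replaces $(d_i^0,x,d_j^1)$ by $(d_{j-1}^1,x',d_i^0)$ or $(d_j^0,x,d_i^1)$ by $(d_i^1,x',d_{j-1}^0)$ (if the step directly before is an up-step). This stops when the step directly before it, at position $k$, is an up-step with the same index; put $\mathrm{start}(p)=k$. $\mathsf{ST}(\alpha)$ is the sequence whose $j$-th entry is $a^+$ if $\varphi_j$ is an up-step starting an event labelled $a$ (the label of the $i_j$-th event of $U_j$), and $a^{\mathrm{start}(j)}$ if $\varphi_j$ is a down-step ending an event labelled $a$ (the label of the $i_j$-th event of $U_{j-1}$). $I$-bisimulations. For $I\subseteq\{\sqsubseteq,\sqsupseteq,\leftrightarrows,\hookleftarrow\}$, an $I$-bisimulation between HDAs $\mathcal Y,\mathcal Z$ is a relation $\mathfrak R$ between paths of $\mathcal Y$ and of $\mathcal Z$ satisfying the following clauses, each also with the roles of $\mathcal Y$ and $\mathcal Z$ exchanged: (1) the length-$0$ paths of $\mathcal Y$ and $\mathcal Z$ are related; (2) if $(\alpha,\beta)\in\mathfrak R$ then $\mathsf{ST}(\alpha)=\mathsf{ST}(\beta)$; (3) if $(\alpha,\beta)\in\mathfrak R$ and $\alpha\hookrightarrow\alpha'$, there is $\beta'$ with $\beta\hookrightarrow\beta'$ and $(\alpha',\beta')\in\mathfrak R$; and those of the following whose symbol lies in $I$: ($\sqsubseteq$) if $(\alpha,\beta)\in\mathfrak R$ and $\alpha\sqsubseteq^\ell\alpha'$, there is $\beta'$ with $\beta\sqsubseteq^\ell\beta'$, $(\alpha',\beta')\in\mathfrak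 R$; ($\sqsupseteq$) the same with $\alpha'\sqsubseteq^\ell\alpha$ and $\beta'\sqsubseteq^\ell\beta$; ($\leftrightarrows$) the same with $\alpha'\leftrightarrows^\ell\alpha$ and $\beta'\leftrightarrows^\ell\beta$; ($\hookleftarrow$) the same with $\alpha'\hookrightarrow\alpha$ and $\beta'\hookrightarrow\beta$. $\mathcal Y,\mathcal Z$ are $I$-bisimilar, $\mathcal Y\,\underline{\leftrightarrow}_I\,\mathcal Z$, if an $I$-bisimulation between them exists. Names: ST is $I=\emptyset$; shp is $I=\{\sqsubseteq\}$; ureST is $I=\{\sqsupseteq,\leftrightarrows,\hookleftarrow\}$. *)

(* Defs.v *)
From mathcomp Require Import all_boot.

Set Implicit Arguments.
Unset Strict Implicit.
Unset Printing Implicit Defensive.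

(* Positions in conclists, and hence the indices i of d_i^k, count from 0.
   Positions in paths count from 1: the step phi_1 leads from x_0 to x_1. *)

Section HDAs.
Variable Sigma : Type.

(* The conclist (n, lambda) is the word lambda(1) ... lambda(n). *)
Definition conclist := seq Sigma.

Definition lab (U : conclist) (i : 'I_(size U)) : Sigma := tnth (in_tuple U) i.

(* In the values of [eps], None stands for *, Some false for 0 and
   Some true for 1. *)
Record hom (U V : conclist) := Hom {
  emb : 'I_(size U) -> 'I_(size V);
  eps : 'I_(size V) -> option bool;
  emb_inj : injective emb;
  emb_mono : forall s t : 'I_(size U), s <= t -> emb s <= emb t;
  emb_lab : forall t, lab (emb t) = lab t;
  eps_star : forall v, eps v = None <-> exists t, emb t = v
}.

Lemma id_star (U : conclist) (v : 'I_(size U)) :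
  None = None :> option bool <-> exists t, t = v.
Proof. by split=> // _; exists v. Qed.

Definition hom_id (U : conclist) : hom U U :=
  @Hom U U (fun t => t) (fun _ => None) (fun _ _ e => e)
    (fun _ _ le => le) (fun _ => erefl) (@id_star U).

Section Comp.
Variables (U V W : conclist) (g : hom V W) (f : hom U V).

Definition comp_emb (t : 'I_(size U)) := emb g (emb f t).

Definition comp_eps (w : 'I_(size W)) : option bool :=
  if [pick v | emb g v == w] is Some v then eps f v else eps g w.

Lemma comp_inj : injective comp_emb.
Proof. by move=> s t /emb_inj/emb_inj. Qed.

Lemma comp_mono (s t : 'I_(size U)) : s <= t -> comp_emb s <= comp_emb t.
Proof. by move=> le; do 2!apply: emb_mono. Qed.

Lemma comp_lab t : lab (comp_emb t) = lab t.
Proof. by rewrite /comp_emb !emb_lab. Qed.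

Lemma comp_star w : comp_eps w = None <-> exists t, comp_emb t = w.
Proof.
rewrite /comp_eps; case: pickP => [v /eqP <-|no]; split.
- by case/eps_star=> t <-; exists t.
- by case=> t /emb_inj <-; apply/eps_star; exists t.
- by case/eps_star=> v /eqP; rewrite no.
- by case=> t /eqP; rewrite no.
Qed.

Definition hom_comp : hom U W := Hom comp_inj comp_mono comp_lab comp_star.
End Comp.

(* [d] is the coface map d_i^k. Its embedding is then forced, by [eps_star], to
   be the increasing map onto the positions of V other than i. *)
Definition is_coface (k : bool) (i : nat) (U V : conclist) (d : hom U V) :=
  i < size V /\
  forall v, eps d v = if v == i :> nat then Some k else None.

Record precubical := Precubical {
  cell : conclist -> Type;
  res : forall U V, hom U V -> cell V -> cell U;
  res_id : forall U (x : cell U), res (hom_id U) x = x;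
  res_comp : forall U V W (g : hom V W) (f : hom U V) (x : cell W),
    res (hom_comp g f) x = res f (res g x)
}.

Record hda := Hda {
  pcs :> precubical;
  init : cell pcs [::]
}.

Definition tcell (X : precubical) := {U : conclist & cell X U}.

(* [Up i] is d_i^0 and [Down i] is d_i^1; the conclists between which the
   coface map goes are those of the neighbouring cells of the path. *)
Inductive step := Up of nat | Down of nat.

Definition is_step (X : precubical) (x : tcell X) (phi : step) (y : tcell X) :=
  match phi with
  | Up i => exists d : hom (tag x) (tag y),
      is_coface false i d /\ tagged x = res d (tagged y)
  | Down i => exists d : hom (tag y) (tag x),
      is_coface true i d /\ tagged y = res d (tagged x)
  end.

Fixpoint is_path (X : precubical) (x : tcell X) (s : seq (step * tcell X)) :=
  if s is (phi, y) :: s' then is_step x phi y /\ is_path y s' else True.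

Definition init_cell (X : hda) : tcell X := Tagged (cell X) (init X).

Record hpath (X : hda) := HPath {
  moves :> seq (step * tcell X);
  hpathP : is_path (init_cell X) moves
}.

Definition empty_path (X : hda) : hpath X := @HPath X [::] I.

Definition extends (X : hda) (alpha alpha' : hpath X) :=
  exists s, moves alpha' = moves alpha ++ s.

(* beta arises from alpha by replacing, around the cell x_l, the steps
   (phi, x_l, psi) by (phi', x'_l, psi'). *)
Definition replaced (X : hda) (l : nat) (phi psi phi' psi' : step)
    (alpha beta : hpath X) :=
  exists s1 s2 x x' y, [/\ l = (size s1).+1,
    moves alpha = s1 ++ (phi, x) :: (psi, y) :: s2 &
    moves beta = s1 ++ (phi', x') :: (psi', y) :: s2].

Definition similar_to (X : hda) (l : nat) (alpha beta : hpath X) :=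
  exists i j, i < j /\
    (replaced l (Up i) (Up j) (Up j.-1) (Up i) alpha beta \/
     replaced l (Down j) (Down i) (Down i) (Down j.-1) alpha beta).

Definition similar (X : hda) (l : nat) (alpha beta : hpath X) :=
  similar_to l alpha beta \/ similar_to l beta alpha.

(* beta subsumes alpha *)
Definition subsumed (X : hda) (l : nat) (alpha beta : hpath X) :=
  exists i j, i < j /\
    (replaced l (Up i) (Down j) (Down j.-1) (Up i) beta alpha \/
     replaced l (Up j) (Down i) (Down i) (Up j.-1) beta alpha).

(* [start_from past c] moves a down-step of current index c to the left across
   the steps [past], listed from the nearest one back to phi_1; only the indices
   are tracked, since the replacements do not depend on the cells. The lemmas
   [start_stop] and [start_move] below relate this to paths. On paths the case
   [::] does not arise, as every event that ends has been started. *)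
Fixpoint start_from (past : seq step) (c : nat) : nat :=
  match past with
  | [::] => 0
  | Down q :: past' => start_from past' (if c < q then c else c.+1)
  | Up q :: past' =>
      if q == c then size past
      else start_from past' (if q < c then c.-1 else c)
  end.

Definition start (phis : seq step) (p : nat) : nat :=
  if onth phis p.-1 is Some (Down c) then start_from (rev (take p.-1 phis)) c
  else 0.

Definition steps (X : hda) (alpha : hpath X) : seq step :=
  [seq m.1 | m <- moves alpha].

(* a^+ and a^k. The label is an option because it is looked up by [onth]; on
   paths the index is in range. *)
Inductive st_entry :=
  | Started of option Sigma
  | Ended of option Sigma & nat.

Fixpoint trace_from (X : hda) (phis : seq step) (j : nat) (x : tcell X)
    (s : seq (step * tcell X)) : seq st_entry :=
  if s is (phi, y) :: s' then
    (match phi with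
     | Up i => Started (onth (tag y) i)
     | Down i => Ended (onth (tag x) i) (start phis j)
     end) :: trace_from phis j.+1 y s'
  else [::].

Definition ST (X : hda) (alpha : hpath X) : seq st_entry :=
  trace_from (steps alpha) 1 (init_cell X) (moves alpha).

Inductive symbol := Sub | Sup | Sim | Back.

Record bisim_half (I : symbol -> Prop) (Y Z : hda)
    (R : hpath Y -> hpath Z -> Prop) : Prop := {
  bisim_init : R (empty_path Y) (empty_path Z);
  bisim_ST : forall alpha beta, R alpha beta -> ST alpha = ST beta;
  bisim_ext : forall alpha beta alpha', R alpha beta -> extends alpha alpha' ->
    exists beta', extends beta beta' /\ R alpha' beta';
  bisim_sub : I Sub -> forall l alpha beta alpha',
    R alpha beta -> subsumed l alpha alpha' ->
    exists beta', subsumed l beta beta' /\ R alpha' beta';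
  bisim_sup : I Sup -> forall l alpha beta alpha',
    R alpha beta -> subsumed l alpha' alpha ->
    exists beta', subsumed l beta' beta /\ R alpha' beta';
  bisim_sim : I Sim -> forall l alpha beta alpha',
    R alpha beta -> similar l alpha' alpha ->
    exists beta', similar l beta' beta /\ R alpha' beta';
  bisim_back : I Back -> forall alpha beta alpha',
    R alpha beta -> extends alpha' alpha ->
    exists beta', extends beta' beta /\ R alpha' beta'
}.

Definition bisimulation (I : symbol -> Prop) (Y Z : hda)
    (R : hpath Y -> hpath Z -> Prop) :=
  bisim_half I R /\ bisim_half I (fun beta alpha => R alpha beta).

Definition bisimilar (I : symbol -> Prop) (Y Z : hda) :=
  exists R : hpath Y -> hpath Z -> Prop, bisimulation I R.

Definition ST_bisimilar := bisimilar (fun _ => False).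
Definition shp_bisimilar := bisimilar (fun s => s = Sub).
Definition ureST_bisimilar :=
  bisimilar (fun s => s = Sup \/ s = Sim \/ s = Back).

Lemma start_cat s1 phi s2 c :
  start (s1 ++ phi :: Down c :: s2) (size s1).+2
    = start_from (phi :: rev s1) c.
Proof.
rewrite /start -cat_rcons -(size_rcons s1 phi) onth_cat ltnn subnn /=.
by rewrite take_size_cat // rev_rcons.
Qed.

(* Moving stops at an up-step of the same index. *)
Lemma start_stop (X : hda) (alpha : hpath X) p c :
  onth (steps alpha) p = Some (Up c) ->
  onth (steps alpha) p.+1 = Some (Down c) ->
  start (steps alpha) p.+2 = p.+1.
Proof.
move: (steps alpha) => s up dn; rewrite /start -[p.+2.-1]/(p.+1) dn.
have lt : p < size s by rewrite -onthTE up.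
move/(onth_nth (Up 0)): up => up.
by rewrite (take_nth (Up 0)) // rev_rcons up /= eqxx size_rev size_takel // ltnW.
Qed.

(* A replacement that moves the down-step at position l + 1 to position l does
   not change its start. *)
Lemma start_move (X : hda) (l : nat) (alpha beta : hpath X) c :
  onth (steps alpha) l = Some (Down c) ->
  similar l beta alpha \/ subsumed l beta alpha ->
  (exists c', onth (steps beta) l.-1 = Some (Down c')) /\
  start (steps alpha) l.+1 = start (steps beta) l.
Proof.
have aux phi d phi' c' s1 (s2 : seq (step * tcell X)) x x' y :
    let u := s1 ++ (phi, x) :: (Down d, y) :: s2 in
    let v := s1 ++ (Down c', x') :: (phi', y) :: s2 in
    let us := [seq m.1 | m <- u] in let vs := [seq m.1 | m <- v] in
    start_from (phi :: rev [seq m.1 | m <- s1]) d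
      = start_from (rev [seq m.1 | m <- s1]) c' ->
    (exists c', onth vs (size s1) = Some (Down c')) /\
    start us (size s1).+2 = start vs (size s1).+1.
  move=> u v us vs e; rewrite /us /vs /u /v !map_cat !map_cons.
  rewrite -(size_map (fun m => m.1) s1).
  rewrite start_cat e /start onth_cat ltnn subnn /= take_size_cat //.
  by split=> //; exists c'.
have noup s1 phi i (s2 : seq (step * tcell X)) x y :
    onth [seq m.1 | m <- s1 ++ (phi, x) :: (Up i, y) :: s2] (size s1).+1
      <> Some (Down c).
  by rewrite map_cat onth_cat size_map ltnNge leqnSn /= subSnn.
move=> dn rel; move: dn; rewrite /steps.
case: rel => [[]|] [i [j [ij []]]] [s1 [s2 [x [x' [y [-> -> ->]]]]]] //=;
  try by move/noup.
- move=> _; apply: aux; case: j ij => // j; rewrite ltnS => ij /=.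
  by rewrite ltnNge ij.
- by move=> _; apply: aux => /=; rewrite ij.
- by move=> _; apply: aux => /=; rewrite ltn_eqF // ij.
- by move=> _; apply: aux => /=; rewrite gtn_eqF // ltnNge (ltnW ij).
Qed.

End HDAs.

(* Main.v *)
(* The first HDA Z is a filled square folded along its diagonal, with all labels
   allowed on its edges: a cell remembers only its events and whether some event
   has ended, and the edges on which one has ended are loops that are lower faces
   of no square. The second HDA Y has two copies of each of these late edges, of
   which only the unmarked one is an upper face of a square. Forgetting the marks
   maps Y onto Z, and it reflects extensions of paths, because a late edge never
   extends to a square, as well as replacements by smaller or similar paths, which
   only involve faces of squares. So its graph is a ureST-bisimulation. The path of
   Y that executes a and then a again along a marked edge is maximal for
   subsumption, while the only path of Z with the same ST-trace is subsumed by
   the path that first enters the square, so Y and Z are not shp-bisimilar. *)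
Require Import Defs.
From mathcomp Require Import all_boot.

Set Implicit Arguments.
Unset Strict Implicit.
Unset Printing Implicit Defensive.

(** * Dimension and ended events along morphisms of conclists *)

Section Homs.
Variables (Sigma : Type).
Implicit Types U V W : conclist Sigma.

Definition ends U V (h : hom U V) := [exists v, eps h v == Some true].

Lemma hom_size U V (h : hom U V) : size U <= size V.
Proof. by have := leq_card _ (@emb_inj _ _ _ h); rewrite !card_ord. Qed.

Lemma hom_size_ltn U V (h : hom U V) v : eps h v <> None -> size U < size V.
Proof.
move=> nv; have -> : size U = #|codom (emb h)|.
  by rewrite (card_codom (@emb_inj _ _ _ h)) card_ord.
rewrite -[X in _ < X]card_ord.
apply/proper_card/properP; split; first exact/subset_predT.
exists v => //; apply/codomP => -[t vE]; apply: nv.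
by apply/eps_star; exists t.
Qed.

Lemma ends_size U V (h : hom U V) : ends h -> size U < size V.
Proof. by case/existsP=> v /eqP hv; apply: (@hom_size_ltn _ _ h v); rewrite hv. Qed.

Lemma ends_id U : ends (hom_id U) = false.
Proof. by apply/existsP => -[]. Qed.

(** Positions where [g] has value 0 or 1 lie outside the image of [emb g], so [comp_eps] keeps the
    value of [g] there and copies that of [f] on the image. *)
Lemma ends_comp U V W (g : hom V W) (f : hom U V) :
  ends (hom_comp g f) = ends g || ends f.
Proof.
apply/existsP/orP => [[w]|[/existsP[w gw]|/existsP[v fv]]] /=.
- rewrite /comp_eps; case: pickP => [v _ fv|_ gw].
    by right; apply/existsP; exists v.
  by left; apply/existsP; exists w.
- exists w; rewrite /comp_eps; case: pickP => // v /eqP vw.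
  have /eps_star gw0 : exists v, emb g v = w by exists v.
  by rewrite gw0 in gw.
- exists (emb g v); rewrite /comp_eps; case: pickP => [u /eqP /emb_inj -> //|].
  by move/(_ v); rewrite eqxx.
Qed.

(** By [eps_star], the image of the embedding is the complement of position [i]. *)
Lemma coface_size k i U V (h : hom U V) :
  is_coface k i h -> size V = (size U).+1.
Proof.
case=> lti hE; transitivity #|'I_(size V)|; first by rewrite card_ord.
rewrite (cardD1 (Ordinal lti)) inE add1n; congr _.+1.
transitivity #|codom (emb h)|; last by rewrite (card_codom (@emb_inj _ _ _ h)) card_ord.
apply: eq_card => v; rewrite !inE andbT -val_eqE /=.
apply/idP/codomP => [nvi|[t ->]].
  have /eps_star[t <-] : eps h v = None by rewrite hE (negPf nvi).
  by exists t.
have /eps_star : exists u, emb h u = emb h t by exists t.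
by rewrite hE; case: eqP.
Qed.

Lemma coface_ends k i U V (h : hom U V) : is_coface k i h -> ends h = k.
Proof.
case=> lti hE; apply/existsP/idP => [[v]|kT].
  by rewrite hE; case: (v == i :> nat) => // /eqP[].
by exists (Ordinal lti); rewrite hE eqxx kT.
Qed.

End Homs.

Lemma is_path_cat Sigma (X : precubical Sigma) (x : tcell X) s1 s2 :
  is_path x (s1 ++ s2) <->
  is_path x s1 /\ is_path (last x [seq m.2 | m <- s1]) s2.
Proof.
elim: s1 x => [|[phi y] s1 IHs] x /=; first by split=> // -[].
by split=> [[st /IHs[]]|[[st p1] p2]]; split=> //; apply/IHs.
Qed.

Lemma replaced_sym Sigma (X : hda Sigma) l phi psi phi' psi' (alpha beta : hpath X) :
  replaced l phi psi phi' psi' alpha beta ->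
  replaced l phi' psi' phi psi beta alpha.
Proof. by case=> s1 [s2 [x [x' [y [? ? ?]]]]]; exists s1, s2, x', x, y. Qed.

(** * The two HDAs as precubical sets *)

Section Example.
Variables (Sigma : Type).
Implicit Types U V W : conclist Sigma.

(* [p.1] records whether an event has already ended, and [p.2] marks the second
   copy, present only when [B] holds, of the edges on which this is so. *)
Definition admissible (B : bool) (n : nat) (p : bool * bool) :=
  (n + p.1 <= 2) && (p.2 ==> [&& B, p.1 & n == 1]).

Definition ex_cell B U := {p : bool * bool | admissible B (size U) p}.

(** The test on [size U] drops the mark from every face that is not an edge, so the two copies of a
    late edge share their endpoints. Squares are unmarked, hence so are all their faces. *)
Definition face U V (h : hom U V) (p : bool * bool) :=
  (p.1 || ends h, p.2 && (size U == 1)).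

Lemma face_admissible B U V (h : hom U V) p :
  admissible B (size V) p -> admissible B (size U) (face h p).
Proof.
case: p => k t; rewrite /admissible /= => /andP[le2 tP]; apply/andP; split.
  case: k le2 {tP} => /= le2; first by rewrite (leq_trans _ le2) // leq_add2r hom_size.
  (* Ending an event lowers the dimension, which makes up for the flag becoming true. *)
  rewrite addn0 in le2; case: (boolP (ends h)) => [/ends_size lt|_].
    by rewrite addn1 (leq_trans lt).
  by rewrite addn0 (leq_trans (hom_size h)).
by apply/implyP => /andP[t1 ->]; move: tP; rewrite t1 => /and3P[-> ->].
Qed.

Definition ex_res B U V (h : hom U V) (x : ex_cell B V) : ex_cell B U :=
  exist _ (face h (val x)) (face_admissible h (valP x)).

Lemma ex_res_id B U (x : ex_cell B U) : ex_res (hom_id U) x = x.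
Proof.
apply: val_inj; case: x => -[k t] /= /andP[_ /= tP].
rewrite /face /= ends_id orbF; congr pair.
by case: t tP => //= /and3P[_ _ ->].
Qed.

Lemma ex_res_comp B U V W (g : hom V W) (f : hom U V) (x : ex_cell B W) :
  ex_res (hom_comp g f) x = ex_res f (ex_res g x).
Proof.
apply: val_inj; case: x => -[k t] /= /andP[_ /= tP].
rewrite /face /= ends_comp orbA; congr pair.
case: t tP => //= /and3P[_ _ /eqP W1].
case: eqP => [U1|]; last by rewrite andbF.
(* Since [W] and [U] have dimension 1, so has [V] between them, and the mark is not lost on the
   way. *)
have := hom_size g; have := hom_size f; rewrite W1 U1 => V0 V1.
by rewrite andbT eqn_leq V0 V1.
Qed.

Definition ex_pcs B : precubical Sigma :=
  Precubical (@ex_res_id B) (@ex_res_comp B).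

Definition ex_hda B : hda Sigma :=
  @Hda _ (ex_pcs B) (exist _ (false, false) isT).

(** * Flags of cells and their behaviour along steps *)

Notation ecell B := (tcell (ex_pcs B)).

Definition ended B (x : ecell B) := (val (tagged x)).1.
Definition marked B (x : ecell B) := (val (tagged x)).2.

Lemma ecell_inj B (x y : ecell B) :
  tag x = tag y -> ended x = ended y -> marked x = marked y -> x = y.
Proof.
case: x y => U [[k t] p] [V [[k' t'] q]] /= e; case: _ / e q => q.
rewrite /ended /marked /= => kk tt; congr Tagged.
by apply: val_inj; rewrite /= kk tt.
Qed.

Lemma ended_size B (x : ecell B) : size (tag x) + ended x <= 2.
Proof. by have /andP[] := valP (tagged x). Qed.

Lemma markedP B (x : ecell B) :
  marked x -> [/\ B, ended x & size (tag x) = 1].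
Proof.
have /andP[_ /implyP tP] := valP (tagged x); move/tP.
by case/and3P=> bT kT /eqP.
Qed.

Lemma unmarked B (x : ecell B) : 1 < size (tag x) -> marked x = false.
Proof. by move=> lt; apply/negP => /markedP[_ _ e]; rewrite e in lt. Qed.

Lemma unmarkedF (x : ecell false) : marked x = false.
Proof. by apply/negP => /markedP[]. Qed.

(** Here and in [step_downP], the equation between cells is split into one condition per flag, so
    that steps can be built and inverted flag by flag. *)
Lemma step_upP B (x y : ecell B) i : is_step x (Up i) y <->
  [/\ exists d : hom (tag x) (tag y), is_coface false i d,
      ended x = ended y & marked x = marked y && (size (tag x) == 1)].
Proof.
case: x y => U [[k t] p] [V [[k' t'] q]]; split.
  move=> /= [d [dP /= [kk tt]]]; rewrite /ended /marked /=.
  by split; [exists d | rewrite kk (coface_ends dP) orbF |].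
rewrite /ended /marked /= => -[[d dP] kk tt]; exists d; split=> //.
by apply: val_inj; rewrite /= /face /= (coface_ends dP) orbF kk tt.
Qed.

Lemma step_downP B (x y : ecell B) i : is_step x (Down i) y <->
  [/\ exists d : hom (tag y) (tag x), is_coface true i d,
      ended y & marked y = marked x && (size (tag y) == 1)].
Proof.
case: x y => U [[k t] p] [V [[k' t'] q]]; split.
  move=> /= [d [dP /= [kk tt]]]; rewrite /ended /marked /=.
  by split; [exists d | rewrite kk (coface_ends dP) orbT |].
rewrite /ended /marked /= => -[[d dP] kk tt]; exists d; split=> //.
by apply: val_inj; rewrite /= /face /= (coface_ends dP) orbT kk tt.
Qed.

Lemma up_size B (x y : ecell B) i :
  is_step x (Up i) y -> i < size (tag y) /\ size (tag y) = (size (tag x)).+1.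
Proof. by case/step_upP=> -[d dP] _ _; split; [case: dP | apply: coface_size dP]. Qed.

Lemma down_size B (x y : ecell B) i :
  is_step x (Down i) y -> i < size (tag x) /\ size (tag x) = (size (tag y)).+1.
Proof. by case/step_downP=> -[d dP] _ _; split; [case: dP | apply: coface_size dP]. Qed.

(** * Forgetting the marks *)

Lemma unmark_admissible B B' n p :
  admissible B n p -> admissible B' n (p.1, false).
Proof. by rewrite /admissible /= andbT => /andP[]. Qed.

(** The two parameters let one map serve both as the projection of Y onto Z and as its section,
    which embeds Z as the unmarked part of Y. *)
Definition unmark B B' (x : ecell B) : ecell B' :=
  @Tagged _ (tag x) (cell (ex_pcs B'))
    (exist _ (ended x, false) (unmark_admissible B' (valP (tagged x)))).

Lemma unmarkK B B' (x : ecell B) :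
  marked x = false -> unmark B (unmark B' x) = x.
Proof. by move=> mx; apply: ecell_inj. Qed.

Lemma unmark_step B B' (x y : ecell B) phi :
  is_step x phi y -> is_step (unmark B' x) phi (unmark B' y).
Proof.
by case: phi => i; [case/step_upP=> xy e _; apply/step_upP
                   |case/step_downP=> xy e _; apply/step_downP].
Qed.

Lemma step_unmark B B' (x y : ecell B) phi : marked x = false ->
  marked y = false -> is_step (unmark B' x) phi (unmark B' y) -> is_step x phi y.
Proof.
by move=> mx my /(unmark_step B); rewrite !unmarkK.
Qed.

(* An edge on which an event has ended is not a lower face of a square. *)
Lemma marked_up B B' (x : ecell B) i (z : ecell B') :
  is_step (unmark B' x) (Up i) z -> marked x = false.
Proof.
move=> st; apply/negP => /markedP[_ kx x1].
case/up_size: (st) => _; rewrite /= x1 => z2.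
by case/step_upP: st (ended_size z) => _ <- _; rewrite /ended /= kx z2.
Qed.

(** These pairs of steps touch a square. They cover both sides of a similarity and the larger side
    of a subsumption; the smaller side, a down-step before an up-step, is excluded because its
    up-step may enter a marked edge. *)
Definition interchange phi psi := match phi, psi with
  | Up i, Down j => i <> j
  | Down _, Up _ => False
  | _, _ => True
  end.

(** One of the three cells has dimension at least 2 and is therefore unmarked, and being unmarked
    passes to faces. *)
Lemma interchange_unmarked B (w x y : ecell B) phi psi :
  interchange phi psi -> is_step w phi x -> is_step x psi y ->
  marked w = false /\ marked y = false.
Proof.
have up u v i : is_step u (Up i) v -> marked v = false -> marked u = false.
  by case/step_upP=> _ _ -> ->.
have down u v i : is_step u (Down i) v -> marked u = false -> marked v = false.
  by case/step_downP=> _ _ -> ->.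
case: phi psi => i [] j ij wx xy; try by case: ij.
- have my : marked y = false.
    by apply: unmarked; case/up_size: xy => _ ->; case/up_size: wx => _ ->.
  by split=> //; apply: (up _ _ _ _ wx); apply: (up _ _ _ _ xy).
- have mx : marked x = false.
    apply: unmarked; case/up_size: wx => ilt _; case/down_size: xy => jlt _.
    (* Two distinct indices below the dimension of [x] force it to be at least 2. *)
    by move: (size _) ilt jlt ij => [|[|n]] //; case: i => // _; case: j.
  by split; [apply: (up _ _ _ _ wx) | apply: (down _ _ _ _ xy)].
- have mw : marked w = false.
    by apply: unmarked; case/down_size: wx => _ ->; case/down_size: xy => _ ->.
  by split=> //; apply: (down _ _ _ _ xy); apply: (down _ _ _ _ wx).
Qed.

(** * Projecting and lifting paths *)

Definition unmarks B B' (s : seq (step * ecell B)) : seq (step * ecell B') :=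
  [seq (m.1, unmark B' m.2) | m <- s].

Lemma unmark_init B B' :
  unmark B' (init_cell (ex_hda B)) = init_cell (ex_hda B').
Proof. exact: ecell_inj. Qed.

Lemma unmark_path B B' (x : ecell B) s :
  is_path x s -> is_path (unmark B' x) (unmarks B' s).
Proof.
by elim: s x => //= -[phi y] s IHs x [st /IHs]; split=> //; apply: unmark_step.
Qed.

Lemma unmark_hpath B B' (alpha : hpath (ex_hda B)) :
  is_path (init_cell (ex_hda B')) (unmarks B' alpha).
Proof. by rewrite -(unmark_init B); apply: unmark_path (hpathP alpha). Qed.

(** A down-step lifts by restricting [x] along the same coface map. If an up-step leaves the image
    of [x], then [x] is unmarked by [marked_up], and the unmarked copy of [z] will do. *)
Lemma lift_step B (x : ecell B) phi (z : ecell false) :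
  is_step (unmark false x) phi z ->
  exists2 y, is_step x phi y & unmark false y = z.
Proof.
case: phi => i st; last first.
  case/step_downP: (st) => -[d dP] zT _.
  pose y := @Tagged _ (tag z) (cell (ex_pcs B)) (ex_res d (tagged x)).
  exists y; first by exists d.
  apply: ecell_inj => //; last by rewrite !unmarkedF.
  by rewrite zT -[LHS]/(ended x || ends d) (coface_ends dP) orbT.
have mx := marked_up st; exists (unmark B z); last by rewrite unmarkK ?unmarkedF.
by move/(unmark_step B): st; rewrite unmarkK.
Qed.

Lemma lift_path B (x : ecell B) s : is_path (unmark false x) s ->
  exists2 s', is_path x s' & unmarks false s' = s.
Proof.
elim: s x => [|[phi z] s IHs] x /=; first by exists [::].
case=> /lift_step[y xy <-] /IHs[s' ys' <-].
by exists ((phi, y) :: s').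
Qed.

Lemma unmarks_last B B' (x : ecell B) s :
  last (unmark B' x) [seq m.2 | m <- unmarks B' s]
    = unmark B' (last x [seq m.2 | m <- s]).
Proof. by elim: s x => //= -[phi y] s IHs x; apply: IHs. Qed.

Lemma trace_from_unmarks B B' phis j (x : ecell B) s :
  @trace_from _ (ex_hda B') phis j (unmark B' x) (unmarks B' s)
    = @trace_from _ (ex_hda B) phis j x s.
Proof. by elim: s x j => //= -[phi y] s IHs x j; rewrite IHs; case: phi. Qed.

(** * The graph of the projection as a ureST-bisimulation *)

Section Unmarking.
Variable B : bool.
Implicit Types (alpha : hpath (ex_hda B)) (beta : hpath (ex_hda false)).

Definition unmarks_to alpha beta := unmarks false alpha = beta.

Lemma unmarks_to_ST alpha beta : unmarks_to alpha beta -> ST alpha = ST beta.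
Proof.
rewrite /ST /steps -(unmark_init B false) => <-.
by rewrite trace_from_unmarks -map_comp; congr trace_from; apply: eq_map.
Qed.

Lemma unmarks_to_replaced l phi psi phi' psi' alpha alpha' beta beta' :
  unmarks_to alpha beta -> unmarks_to alpha' beta' ->
  replaced l phi psi phi' psi' alpha alpha' ->
  replaced l phi psi phi' psi' beta beta'.
Proof.
move=> ab ab' [s1 [s2 [x [x' [y [-> aE aE']]]]]].
exists (unmarks false s1), (unmarks false s2), (unmark false x),
  (unmark false x'), (unmark false y).
by rewrite size_map -ab -ab' aE aE' /unmarks !map_cat.
Qed.

(** Only the cell [x'] is new. Its neighbours in [alpha] are unmarked by [interchange_unmarked], so
    the section carries the new steps of Z back to Y when [x'] is lifted to its unmarked copy. *)
Lemma lift_replaced l phi psi phi' psi' alpha beta beta' :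
  interchange phi psi -> unmarks_to alpha beta ->
  replaced l phi psi phi' psi' beta beta' ->
  exists alpha', replaced l phi psi phi' psi' alpha alpha' /\
    unmarks_to alpha' beta'.
Proof.
case: alpha beta beta' => s aP [t bP] [t' bP'] ic ab.
case=> s1 [s2 [x [x' [y [-> /= tE tE']]]]].
move: ab; rewrite /unmarks_to /= tE => sE.
(* The decomposition of the projected path pulls back to [s], cut at the same length. *)
have {sE} [u [w [v [z [sE s1E xE yE s2E]]]]] :
    exists u w v z, [/\ s = u ++ (phi, w) :: (psi, v) :: z,
      s1 = unmarks false u, unmark false w = x, unmark false v = y &
      unmarks false z = s2].
  have : unmarks false (take (size s1) s) = s1.
    by rewrite /unmarks map_take -/(unmarks false s) sE take_size_cat.
  have : unmarks false (drop (size s1) s) = (phi, x) :: (psi, y) :: s2.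
    by rewrite /unmarks map_drop -/(unmarks false s) sE drop_size_cat.
  rewrite -{3}(cat_take_drop (size s1) s).
  case: (drop _ s) => [//|[p w] [//|[q v] z]] /= [-> wx -> vy zs] us.
  by exists (take (size s1) s), w, v, z.
subst s1 s2.
have := aP; rewrite [X in is_path _ X]sE => aP'.
case/is_path_cat: aP' => pu [st1 [st2 pz]].
have := bP'; rewrite [X in is_path _ X]tE' -yE => bP''.
case/is_path_cat: bP'' => _ [].
rewrite -(unmark_init B false) unmarks_last.
set r := last _ _ => st1' [st2' _].
have [mr mv] := interchange_unmarked ic st1 st2.
suff a'P : is_path (init_cell (ex_hda B))
    (u ++ (phi', unmark B x') :: (psi', v) :: z).
  exists (HPath a'P); split.
    by exists u, z, w, (unmark B x'), v; rewrite size_map.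
  rewrite /unmarks_to /= tE' -yE /unmarks map_cat /=.
  by rewrite unmarkK ?unmarkedF.
apply/is_path_cat; split=> //; split.
  by move/(unmark_step B): st1'; rewrite unmarkK.
split=> //.
by move/(unmark_step B): st2'; rewrite unmarkK.
Qed.

Lemma unmarks_to_bisim :
  bisimulation (fun s => s = Sup \/ s = Sim \/ s = Back) unmarks_to.
Proof.
(* From Y to Z every matching path is simply the projection; only the exchanged clauses need
   lifting. *)
have dn alpha : exists beta, unmarks_to alpha beta.
  by exists (HPath (unmark_hpath false alpha)).
split; split; rewrite /unmarks_to //.
- exact: unmarks_to_ST.
- move=> al be al' ab [s aE].
  have [be' ab'] := dn al'; exists be'; split=> //.
  by exists (unmarks false s); rewrite -ab' aE -ab /unmarks map_cat.
- by case=> [//|[]].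
- move=> _ l al be al' ab [i [j [ij rep]]].
  have [be' ab'] := dn al'; exists be'; split=> //; exists i, j; split=> //.
  by case: rep => rep; [left|right]; apply: (unmarks_to_replaced ab ab').
- move=> _ l al be al' ab sim.
  have [be' ab'] := dn al'; exists be'; split=> //.
  case: sim => -[i [j [ij rep]]]; [left|right]; exists i, j; split=> //;
    by case: rep => rep; [left|right]; exact: unmarks_to_replaced rep.
- move=> _ al be al' ab [s aE].
  have [be' ab'] := dn al'; exists be'; split=> //.
  by exists (unmarks false s); rewrite -ab' -ab aE /unmarks map_cat.
- by move=> be al /unmarks_to_ST.
- move=> be al be' ab [t tE].
  have := hpathP be'; rewrite tE => /is_path_cat[_].
  rewrite -ab -(unmark_init B) unmarks_last => /lift_path[s sP st].
  have a'P : is_path (init_cell (ex_hda B)) (al ++ s).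
    by apply/is_path_cat; split=> //; apply: hpathP.
  exists (HPath a'P); split; first by exists s.
by rewrite /= /unmarks map_cat -/(unmarks _ _) -st.
- by case=> [//|[]].
- move=> _ l be al be' ab [i [j [ij rep]]].
  (* The given path [be] is on the larger side, so its two steps form an [interchange] pair. *)
  have ne : i <> j by move=> e; rewrite e ltnn in ij.
  case: rep => rep.
  + have [//|al' [rep' ab']] := lift_replaced _ ab rep.
    by exists al'; split=> //; exists i, j; split=> //; left.
  + have [|al' [rep' ab']] := lift_replaced _ ab rep; first exact/nesym.
    by exists al'; split=> //; exists i, j; split=> //; right.
- move=> _ l be al be' ab sim.
  case: sim => -[i [j [ij [rep|rep]]]].
  + have [//|al' [rep' ab']] := lift_replaced _ ab (replaced_sym rep).
    by exists al'; split=> //; left; exists i, j; split=> //; left; apply: replaced_sym.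
  + have [//|al' [rep' ab']] := lift_replaced _ ab (replaced_sym rep).
    by exists al'; split=> //; left; exists i, j; split=> //; right; apply: replaced_sym.
  + have [//|al' [rep' ab']] := lift_replaced _ ab rep.
    by exists al'; split=> //; right; exists i, j; split=> //; left.
  + have [//|al' [rep' ab']] := lift_replaced _ ab rep.
    by exists al'; split=> //; right; exists i, j; split=> //; right.
- move=> _ be al be' ab [t tE].
  have := hpathP al; rewrite -(cat_take_drop (size be') al) => /is_path_cat[pP _].
  exists (HPath pP); split; first by exists (drop (size be') al); rewrite cat_take_drop.
  by rewrite /= /unmarks map_take -/(unmarks _ _) ab tE take_size_cat.
Qed.

End Unmarking.

(** In a constant word, deleting any position leaves the same shorter word, so [lift] preserves
    labels. *)
Lemma coface_nseq (a : Sigma) n k i : i <= n ->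
  exists d : hom (nseq n a) (nseq n.+1 a), is_coface k i d.
Proof.
pose U := nseq n a; pose V := a :: U => le_in.
have ltiV : i < size V by rewrite /= size_nseq.
pose h : 'I_(size V) := Ordinal ltiV; pose f : 'I_(size U) -> 'I_(size V) := lift h.
have labE m (j : 'I_(size (nseq m a))) : lab j = a.
  by rewrite /lab (tnth_nth a) nth_nseq if_same.
have f_mono (s t : 'I_(size U)) : s <= t -> f s <= f t by rewrite /= leq_bump2.
have f_lab t : lab (f t) = lab t by rewrite (labE n) (labE n.+1).
pose e (v : 'I_(size V)) := if v == i :> nat then Some k else None.
have f_star v : e v = None <-> exists t, f t = v.
  rewrite /e -[i]/(val h) val_eqE; case: (unliftP h v) => [t ->|->].
    by rewrite eq_sym (negPf (neq_lift h t)); split=> // _; exists t.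
  by rewrite eqxx; split=> // -[t] /eqP; rewrite eq_sym (negPf (neq_lift h t)).
by exists (@Hom _ U V f e (@lift_inj _ h) f_mono f_lab f_star).
Qed.

(** * The subsumption present in Z but missing in Y *)

Section NotShp.
Variable a : Sigma.

Definition ecell_of B n p (ok : admissible B (size (nseq n a)) p) : ecell B :=
  @Tagged _ (nseq n a) (cell (ex_pcs B)) (exist _ p ok).

Definition early_edge B : ecell B := @ecell_of B 1 (false, false) isT.
Definition mid_vertex B : ecell B := @ecell_of B 0 (true, false) isT.
Definition late_edge B : ecell B := @ecell_of B 1 (true, false) isT.
Definition marked_edge : ecell true := @ecell_of true 1 (true, true) isT.
Definition square B : ecell B := @ecell_of B 2 (false, false) isT.

Lemma marked_path : is_path (init_cell (ex_hda true))
  [:: (Up 0, early_edge true); (Down 0, mid_vertex true); (Up 0, marked_edge)].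
Proof.
split; first by apply/step_upP; split=> //; apply: (@coface_nseq a 0).
split; first by apply/step_downP; split=> //; apply: (@coface_nseq a 0).
by split=> //; apply/step_upP; split=> //; apply: (@coface_nseq a 0).
Qed.

(** The second [Up 0] inserts the new event in front, so [Down 1] ends the event that started
    first. *)
Lemma square_path B : is_path (init_cell (ex_hda B))
  [:: (Up 0, early_edge B); (Up 0, square B); (Down 1, late_edge B)].
Proof.
split; first by apply/step_upP; split=> //; apply: (@coface_nseq a 0).
split; first by apply/step_upP; split=> //; apply: (@coface_nseq a 1).
by split=> //; apply/step_downP; split=> //; apply: (@coface_nseq a 1).
Qed.

(** The trace fixes the kinds of the steps and the labels; the dimensions leave only index 0, and in
    Z a cell is determined by its events and its [ended] flag. *)
Lemma ST_marked_path (beta : hpath (ex_hda false)) :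
  ST (HPath marked_path) = ST beta ->
  exists x, moves beta =
    [:: (Up 0, early_edge false); (Down 0, x); (Up 0, late_edge false)].
Proof.
have edge i (y : ecell false) : i < size (tag y) -> size (tag y) = 1 ->
    Some a = onth (tag y) i -> i = 0 /\ tag y = [:: a].
  by case: y => -[|b [|? ?]] //= p; case: i => // _ _ [<-].
(* Generalizing the step lists makes the values of [start] opaque: the order of starts and ends and
   the labels suffice. *)
case: beta => s sP; rewrite /ST /=; move: (steps _) (steps _) => phis psis.
case: s sP => [|[[i1|//] x1] [|[[//|i2] x2] [|[[i3|//] x3] [|[? ?] ?]]]] //=.
case=> st1 [st2 [st3 _]] [l1 l2 _ l3].
have {}st1 : is_step (init_cell (ex_hda false)) (Up i1) x1 := st1.
have {}st2 : is_step x1 (Down i2) x2 := st2.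
have {}st3 : is_step x2 (Up i3) x3 := st3.
have [lt1 s1] := up_size st1; have [lt2 s2] := down_size st2.
have [lt3 s3] := up_size st3.
rewrite s1 in s2; case: s2 => s2; rewrite -s2 in s3.
have [i1E t1] := edge _ _ lt1 s1 l1; have [i3E t3] := edge _ _ lt3 s3 l3.
have i2E : i2 = 0 by move: lt2; rewrite s1; case: (i2).
rewrite i1E i2E i3E.
case/step_upP: st1 => _ e1 _; case/step_downP: st2 => _ e2 _.
case/step_upP: st3 => _ e3 _.
exists x2; congr [:: (_, _); _; (_, _)]; apply: ecell_inj => //.
- by rewrite unmarkedF.
- by rewrite -e3 e2.
- by rewrite unmarkedF.
Qed.

Lemma ex_not_shp : ~ shp_bisimilar (ex_hda true) (ex_hda false).
Proof.
case=> R [h1 h2].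
have ext : extends (empty_path (ex_hda true)) (HPath marked_path).
  by exists (HPath marked_path).
have [beta [_ Rab]] := bisim_ext h1 (bisim_init h1) ext.
have [x betaE] := ST_marked_path (bisim_ST h1 Rab).
have sub : subsumed 2 beta (HPath (square_path false)).
  exists 0, 1; split=> //; left.
  by exists [:: (Up 0, early_edge false)], [::], (square false), x, (late_edge false).
(* The exchanged half yields a path [s] of Y that subsumes the marked path and so reaches
   [marked_edge] by an [interchange] pair. *)
have [[s sP] [[i [j [ij rep]]] _]] := bisim_sub h2 erefl Rab sub.
have no_square w phi psi u : interchange phi psi ->
    ~ (is_step w phi u /\ is_step u psi marked_edge).
  by move=> ic [wu um]; case: (interchange_unmarked ic wu um).
have ne : i <> j by move=> e; rewrite e ltnn in ij.
case: rep => [] [s1 [s2 [u [u' [y [s1E /= sE mE]]]]]].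
all: case: s1 s1E sE mE => [|[p v] [|? ?]] //= _ sE [_ _ _ _ _ yE _].
all: move: sP; rewrite sE -yE => -[_ [wu [uy _]]].
- by apply: (no_square _ _ _ _ _ (conj wu uy)).
- by apply: (no_square _ _ _ _ _ (conj wu uy)) => /esym.
Qed.

End NotShp.

End Example.

(** The same relation works, as fewer optional clauses are demanded. Both shp and ureST thus refine
    ST, which demands none. *)
Lemma bisimilar_sub Sigma (I J : symbol -> Prop) (Y Z : hda Sigma) :
  (forall s, J s -> I s) -> bisimilar I Y Z -> bisimilar J Y Z.
Proof.
move=> JI [R [h1 h2]]; exists R; split; [case: h1|case: h2]; constructor; eauto.
Qed.

Theorem theorem5p7 (Sigma : Type) (a b c d : Sigma)
    (hab : a <> b) (hac : a <> c) (had : a <> d)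
    (hbc : b <> c) (hbd : b <> d) (hcd : c <> d) :
  ((forall Y Z : hda Sigma, shp_bisimilar Y Z -> ST_bisimilar Y Z) /\
   (exists Y Z : hda Sigma, ST_bisimilar Y Z /\ ~ shp_bisimilar Y Z)) /\
  (exists Y Z : hda Sigma, ureST_bisimilar Y Z /\ ~ shp_bisimilar Y Z).
Proof.
have shpF := ex_not_shp a.
have ureST : ureST_bisimilar (ex_hda Sigma true) (ex_hda Sigma false).
  by exists (@unmarks_to _ true); apply: unmarks_to_bisim.
split; last by exists (ex_hda Sigma true), (ex_hda Sigma false).
split; first by move=> Y Z; apply: bisimilar_sub.
exists (ex_hda Sigma true), (ex_hda Sigma false); split=> //.
exact: bisimilar_sub ureST.
Qed.
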